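(* Let $B$ be a unital $\mathbb K$-algebra. For $F,G\in G_B^{\mathrm{inv}}$ put $$F\rhd_l G:=G\circ(IF),\qquad F\rhd_r G:=G\circ(FI),\qquad F\rhd G:=G\circ(F^{-1}IF),\qquad F\rhd' G:=G\circ(FIF^{-1}),$$ and $$F\star_l G:=G\cdot F\circ(IG),\quad F\star_r G:=F\circ(GI)\cdot G,\quad F\bullet G:=G\cdot F\circ(G^{-1}IG),\quad F\bullet' G:=F\circ(GIG^{-1})\cdot G .$$ Then: (1) $(G_B^{\mathrm{inv}},\cdot,\rhd_l)$ is a post-group, with Grossman--Larson law $\overline{\star_l}$; (2) $(G_B^{\mathrm{inv}},\overline{\cdot},\rhd_r)$ is a post-group, with Grossman--Larson law $\overline{\star_r}$; (3) $(G_B^{\mathrm{inv}},\cdot,\rhd)$ is a post-group, with Grossman--Larson law $\overline{\bullet}$; (4) $(G_B^{\mathrm{inv}},\overline{\cdot},\rhd')$ is a post-group, with Grossman--Larson law $\overline{\bullet'}$.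
   Context: $\mathbb K$ is a field of characteristic zero. For a unital $\mathbb K$-algebra $B$, $\mathrm{Mult}[[B]]$ is the set of sequences $f=(f_n)_{n\ge0}$ of $\mathbb K$-multilinear maps $f_n:B^{\otimes n}\to B$ (with $B^{\otimes 0}=\mathbb K$, so $f_0$ is identified with an element of $B$). Product: $(f\cdot g)_n(x_1,\dots,x_n)=\sum_{k=0}^n f_k(x_1,\dots,x_k)\,g_{n-k}(x_{k+1},\dots,x_n)$, also written $fg$, with unit $1=(\delta_{n,0}1)_n$. Composition, when $g_0=0$: $(f\circ g)_n(x_1,\dots,x_n)=\sum_{l\ge0}\sum_{k_1+\cdots+k_l=n,\,k_i\ge1}f_l\big(g_{k_1}(x_1,\dots,x_{k_1}),\dots,g_{k_l}(x_{n-k_l+1},\dots,x_n)\big)$, with unit $I=(\delta_{n,1}\mathrm{Id})_n$. Composition takes precedence over multiplication: $f\cdot g\circ h\cdot k=f\cdot(g\circ h)\cdot k$. $G_B^{\mathrm{inv}}=\{f: f_0\in B^\times\}$ is a group for $\cdot$, with inverse $f^{-1}$; $G_B^{\mathrm{dif}}=\{f: f_0=0,\ f_1\in \mathrm{GL}(B)\}$ is a group for $\circ$, with inverse $f^{\circ-1}$. For a binary operation $*$, its opposite is $a\,\overline{*}\,b:=b*a$. A post-group $(G,\cdot,\rhd)$ is a group $(G,\cdot)$ with a map $\rhd:G\times G\to G$ such that for each $b\in G$ the map $a\mapsto b\rhd a$ is an automorphism of $(G,\cdot)$, and $(a*_\rhd b)\rhd c=a\rhd(b\rhd c)$ for all $a,b,c$,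 where $a*_\rhd b:=a\cdot(a\rhd b)$ is the Grossman--Larson product (or law); it is a group law on $G$. *)

(* Defs.v *)
From mathcomp Require Import all_boot all_order all_algebra.
From Stdlib Require Import FunctionalExtensionality ProofIrrelevance IndefiniteDescription.

Set Implicit Arguments.
Unset Strict Implicit.
Unset Printing Implicit Defensive.

Import GRing.Theory.
Local Open Scope ring_scope.

Section Groups.
Variable G : Type.
Implicit Types op tri : G -> G -> G.

(* Groups and post-groups are predicates on binary operations, rather than
   structures on the carrier, because several group laws live on the same one. *)
Definition group_law op : Prop :=
  associative op /\
  exists e : G, [/\ left_id e op, right_id e op
                  & forall x, exists y, op x y = e /\ op y x = e].

Definition opposite op : G -> G -> G := fun a b => op b a.

Definition GL_product op tri : G -> G -> G := fun a b => op a (tri a b).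

Definition group_automorphism op (phi : G -> G) : Prop :=
  bijective phi /\ {morph phi : x y / op x y}.

Definition post_group op tri : Prop :=
  [/\ group_law op,
      forall b, group_automorphism op (tri b)
    & forall a b c, tri (GL_product op tri a b) c = tri a (tri b c)].

End Groups.

Section Mult.
Variables (K : fieldType) (B : algType K).

Definition invertible (x : B) : Prop := exists y, x * y = 1 /\ y * x = 1.

Definition tset n (v : n.-tuple B) (i : 'I_n) (x : B) : n.-tuple B :=
  [tuple if j == i then x else tnth v j | j < n].

Definition multilinear n (h : n.-tuple B -> B) : Prop :=
  forall (v : n.-tuple B) (i : 'I_n), linear (fun x => h (tset v i x)).

(* Mult[[B]] *)
Record mult := Mult {
  mfun :> forall n, n.-tuple B -> B;
  mfun_multilinear : forall n, multilinear (@mfun n) }.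

(* f_k (x_1, ..., x_k), where k is the length of the list s = (x_1, ..., x_k). *)
Definition mapp (f : forall n, n.-tuple B -> B) (s : seq B) : B :=
  f (size s) (in_tuple s).

Lemma mappE f n (v : n.-tuple B) : mapp f v = f n v.
Proof.
rewrite /mapp; case: v => s sP /=; move: (sP); case: _ / (eqP sP) => sP'.
by congr (f _ _); apply: val_inj.
Qed.

Lemma mult_eq (f g : mult) : (forall s, mapp f s = mapp g s) -> f = g.
Proof.
case: f g => [f fP] [g gP] /= fg.
have E : f = g.
  apply: functional_extensionality_dep => n.
  by apply: functional_extensionality => v; rewrite -!mappE.
by case: _ / E gP {fg} => gP; congr Mult; apply: proof_irrelevance.
Qed.

Definition seqlin (h : seq B -> B) :=
  forall s t a x y, h (s ++ (a *: x + y) :: t) =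
                    a *: h (s ++ x :: t) + h (s ++ y :: t).

Lemma val_tset n (v : n.-tuple B) i x :
  tset v i x = take i v ++ x :: drop i.+1 v :> seq B.
Proof.
have szt : size (take i v) = i by rewrite size_take size_tuple ltn_ord.
apply: (@eq_from_nth _ 0).
  rewrite size_tuple size_cat /= size_drop szt size_tuple.
  by rewrite -subSn // subSS addnC subnK // ltnW.
move=> j; rewrite size_tuple => jn.
rewrite (_ : j = Ordinal jn) // -tnth_nth tnth_mktuple /= -val_eqE /=.
rewrite nth_cat szt; case: (ltngtP j i) => [ji|ij|->]; last by rewrite subnn.
  by rewrite nth_take // (tnth_nth 0).
rewrite -[(j - i)%N]prednK ?subn_gt0 //= nth_drop (tnth_nth 0) /=.
by rewrite -subnS subnKC.
Qed.

Lemma multilinear_seq (f : forall n, n.-tuple B -> B) :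
  seqlin (mapp f) -> forall n, multilinear (@f n).
Proof. by move=> H n v i a x y; rewrite -!mappE !val_tset H. Qed.

Lemma mapp_lin (f : mult) : seqlin (mapp f).
Proof.
move=> s t a x y; set n := size (s ++ x :: t).
pose v : n.-tuple B := in_tuple (s ++ x :: t).
have sn : (size s < n)%N by rewrite /n size_cat /= addnS ltnS leq_addr.
have E z : s ++ z :: t = tset v (Ordinal sn) z.
  by rewrite val_tset /= take_size_cat // -(cat_rcons x) drop_size_cat // size_rcons.
by rewrite !E !mappE mfun_multilinear.
Qed.

Lemma seqlin_sum (I : Type) (r : seq I) (P : pred I) (F : I -> seq B -> B) :
  (forall i, P i -> seqlin (F i)) ->
  seqlin (fun s => \sum_(i <- r | P i) F i s).
Proof.
move=> FP s t a x y; rewrite scaler_sumr -big_split /=.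
by apply: eq_bigr => i /FP ->.
Qed.

Lemma seqlin_mul_split (f g : seq B -> B) k : seqlin f -> seqlin g ->
  seqlin (fun s => f (take k s) * g (drop k s)).
Proof.
move=> fP gP s t a x y; rewrite /= !take_cat !drop_cat.
case: ltnP => ks; first by rewrite gP mulrDr scalerAr.
case: (k - size s)%N => [|m] /=; first by rewrite (gP [::]) mulrDr scalerAr.
by rewrite fP mulrDl scalerAl.
Qed.

Definition mmul_fun (f g : mult) n (v : n.-tuple B) : B :=
  \sum_(k < n.+1) mapp f (take k v) * mapp g (drop k v).

Lemma mmul_multilinear f g n : multilinear (@mmul_fun f g n).
Proof.
move: n; apply: multilinear_seq => s t a x y; rewrite /mapp /mmul_fun /=.
have sz z : size (s ++ z :: t) = size (s ++ x :: t) by rewrite !size_cat.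
rewrite (sz (_ + _)) (sz y).
apply: (@seqlin_sum _ _ _ (fun k : 'I_ _ => fun s =>
  mapp f (take k s) * mapp g (drop k s))) => k _.
by apply: seqlin_mul_split; apply: mapp_lin.
Qed.

Definition mmul (f g : mult) : mult := Mult (@mmul_multilinear f g).

Definition mone_fun n (v : n.-tuple B) : B := if n is 0 then 1 else 0.

Lemma mone_multilinear n : multilinear (@mone_fun n).
Proof. by case: n => [v [] | n v i a x y] //=; rewrite scaler0 addr0. Qed.

Definition mone : mult := Mult mone_multilinear.

(* The composition unit (delta_{n,1} Id)_n. *)
Definition mid_fun n : n.-tuple B -> B :=
  if n is 1 then fun v => thead v else fun=> 0.

Lemma mid_multilinear n : multilinear (@mid_fun n).
Proof.
case: n => [|[|n]] v i a x y; rewrite /= ?scaler0 ?addr0 //.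
by rewrite /thead !tnth_mktuple (ord1 i) eqxx.
Qed.

Definition mid : mult := Mult mid_multilinear.

(* The sum over l and (k_1, ..., k_l) with k_i >= 1 and k_1 + ... + k_l = n,
   where l and the k_i are automatically at most n.  The arguments are cut into
   consecutive blocks of lengths k_1, ..., k_l by reshape.  The value g_0 does
   not occur, so the formula makes sense for all g, but it is the composition
   only when g_0 = 0. *)
Definition mcomp_fun (f g : mult) n (v : n.-tuple B) : B :=
  \sum_(l < n.+1)
   \sum_(k : l.-tuple 'I_n.+1 | all (fun i : 'I_n.+1 => 0 < i)%N k
                                && (sumn (map val k) == n))
     mapp f [seq mapp g b | b <- reshape (map val k) v].

Lemma reshape_hole (sh : seq nat) (s t : seq B) (x : B) :
  sumn sh = size (s ++ x :: t) ->
  exists L s' t' R, forall z, reshape sh (s ++ z :: t) = L ++ (s' ++ z :: t') :: R.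
Proof.
elim: sh s => [|k sh IH] s /=; first by rewrite size_cat addnS.
move=> szE; case: (ltnP (size s) k) => ks.
  exists [::], s, (take (k - size s).-1 t), (reshape sh (drop (k - size s).-1 t)).
  move=> z; rewrite take_cat drop_cat ltnNge (ltnW ks) /=.
  by rewrite -{1 2}[(k - size s)%N]prednK ?subn_gt0.
have [|L [s' [t' [R E]]]] := IH (drop k s).
  apply: (@addnI k); rewrite szE !size_cat size_drop addnA.
  by rewrite subnKC.
exists (take k s :: L), s', t', R => z.
rewrite take_cat drop_cat; case: ltngtP ks => // [ks _|ks _]; first by rewrite E.
by rewrite ks subnn take0 drop0 cats0 cat_cons -(E z) ks drop_size take_size.
Qed.

Lemma mcomp_multilinear f g n : multilinear (@mcomp_fun f g n).
Proof.
move: n; apply: multilinear_seq => s t a x y; rewrite /mapp /mcomp_fun /=.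
have sz z : size (s ++ z :: t) = size (s ++ x :: t) by rewrite !size_cat.
rewrite (sz (_ + _)) (sz y).
set n := size (s ++ x :: t).
rewrite scaler_sumr -big_split /=; apply: eq_bigr => l _.
rewrite scaler_sumr -big_split /=; apply: eq_bigr => k /andP[_ /eqP kn].
have [L [s' [t' [R E]]]] := reshape_hole kn.
by rewrite !E !map_cat /= mapp_lin mapp_lin.
Qed.

Definition mcomp (f g : mult) : mult := Mult (@mcomp_multilinear f g).

(* G_B^inv *)
Record Ginv := MkGinv {
  ginv_val :> mult;
  ginv_invertible : invertible (ginv_val 0 [tuple]) }.

Lemma invertible1 : invertible 1.
Proof. by exists 1; rewrite mulr1. Qed.

Lemma invertibleM x y : invertible x -> invertible y -> invertible (x * y).
Proof.
move=> [x' [xx' x'x]] [y' [yy' y'y]]; exists (y' * x'); split.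
  by rewrite mulrA -(mulrA x) yy' mulr1.
by rewrite mulrA -(mulrA y') x'x mulr1.
Qed.

Lemma mmul0 f g : mmul f g 0 [tuple] = f 0 [tuple] * g 0 [tuple].
Proof. by rewrite /= /mmul_fun big_ord1 -!mappE. Qed.

Lemma mcomp0 f g : mcomp f g 0 [tuple] = f 0 [tuple].
Proof.
rewrite /= /mcomp_fun big_ord1 (big_pred1 [tuple]) /= -?mappE //.
by move=> k; rewrite (tuple0 k) /= [RHS]eqxx.
Qed.

Lemma mmul_invertible (F G : Ginv) : invertible (mmul F G 0 [tuple]).
Proof. by rewrite mmul0; apply: invertibleM; apply: ginv_invertible. Qed.

Definition gmul (F G : Ginv) : Ginv := MkGinv (mmul_invertible F G).

Lemma mcomp_invertible (F : Ginv) (g : mult) : invertible (mcomp F g 0 [tuple]).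
Proof. by rewrite mcomp0; apply: ginv_invertible. Qed.

Definition gcomp (F : Ginv) (g : mult) : Ginv := MkGinv (mcomp_invertible F g).

Definition seqmul (f g : seq B -> B) (s : seq B) : B :=
  \sum_(k < (size s).+1) f (take k s) * g (drop k s).

Lemma mapp_mmul f g s : mapp (mmul f g) s = seqmul (mapp f) (mapp g) s.
Proof. by []. Qed.

Lemma seqmul_nil f g : seqmul f g [::] = f [::] * g [::].
Proof. by rewrite /seqmul big_ord1. Qed.

Lemma seqmul_cons f g x s :
  seqmul f g (x :: s) = f [::] * g (x :: s) + seqmul (fun t => f (x :: t)) g s.
Proof. by rewrite /seqmul big_ord_recl. Qed.

Lemma seqmulA f g h s : seqmul f (seqmul g h) s = seqmul (seqmul f g) h s.
Proof.
elim: s f g h => [|x s IH] f g h; first by rewrite !seqmul_nil mulrA.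
rewrite [LHS]seqmul_cons [RHS]seqmul_cons seqmul_nil IH seqmul_cons mulrDr mulrA -addrA.
congr (_ + _); rewrite ![seqmul _ h s]/seqmul mulr_sumr -big_split /=.
by apply: eq_bigr => k _; rewrite seqmul_cons mulrDl mulrA.
Qed.

Lemma mmulA : associative mmul.
Proof. by move=> f g h; apply: mult_eq => s; apply: seqmulA. Qed.

Lemma mapp_mone s : mapp mone s = (s == [::])%:R.
Proof. by case: s. Qed.

Lemma mmul1m : left_id mone mmul.
Proof.
move=> f; apply: mult_eq => s; rewrite mapp_mmul; case: s => [|x s].
  by rewrite seqmul_nil mapp_mone mul1r.
rewrite seqmul_cons mapp_mone mul1r /seqmul big1 ?addr0 // => k _.
by rewrite mapp_mone mul0r.
Qed.

Lemma mmulm1 : right_id mone mmul.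
Proof.
move=> f; apply: mult_eq => s; rewrite mapp_mmul /seqmul big_ord_recr /=.
rewrite drop_size take_size mapp_mone mulr1 big1 ?add0r // => k _.
by rewrite mapp_mone -size_eq0 size_drop subn_eq0 leqNgt ltn_ord mulr0.
Qed.

Section Inverse.
Variables (f : mult) (u : B).

Fixpoint inv_rec n (s : seq B) : B :=
  if n is m.+1 then
    if s is [::] then u else
    - (u * \sum_(k < size s) mapp f (take k.+1 s) * inv_rec m (drop k.+1 s))
  else 0.

Lemma inv_rec_lin n : seqlin (inv_rec n).
Proof.
elim: n => [|n IH] s t a x y; first by rewrite /= scaler0 addr0.
have E z : inv_rec n.+1 (s ++ z :: t) = - (u * \sum_(k < (size s + size t).+1)
    mapp f (take k.+1 (s ++ z :: t)) * inv_rec n (drop k.+1 (s ++ z :: t))).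
  by rewrite -addnS -[(size t).+1]/(size (z :: t)) -size_cat; case: s.
rewrite !E; have /= -> := @seqlin_sum _ (index_enum 'I_(size s + size t).+1)
   xpredT (fun k s => mapp f (take k.+1 s) * inv_rec n (drop k.+1 s)).
  by rewrite mulrDr opprD -scalerAr scalerN.
by move=> k _; apply: seqlin_mul_split => //; apply: mapp_lin.
Qed.

Lemma inv_rec_stable m n s : (size s < m)%N -> (size s < n)%N ->
  inv_rec m s = inv_rec n s.
Proof.
elim: m n s => // m IH [|n] [|x s] //= sm sn; congr (- (u * _)).
by apply: eq_bigr => k _; congr (_ * _); apply: IH;
  rewrite size_drop (leq_ltn_trans (leq_subr _ _)).
Qed.

Definition inv_fun n (v : n.-tuple B) : B := inv_rec n.+1 v.

Lemma inv_multilinear n : multilinear (@inv_fun n).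
Proof. by move=> v i a x y; rewrite /inv_fun !val_tset inv_rec_lin. Qed.

Lemma inv_right : f 0 [tuple] * u = 1 -> mmul f (Mult inv_multilinear) = mone.
Proof.
rewrite -mappE => fu; apply: mult_eq => s; rewrite mapp_mmul mapp_mone.
case: s => [|x s]; first by rewrite seqmul_nil.
have -> : seqmul (mapp f) (mapp (Mult inv_multilinear)) (x :: s) =
    seqmul (mapp f) (inv_rec (size s).+2) (x :: s).
  apply: eq_bigr => k _; congr (_ * _); apply: inv_rec_stable => //.
  by rewrite size_drop ltnS leq_subr.
rewrite /seqmul big_ord_recl drop0 /= mulrN mulrA fu mul1r.
apply/eqP; rewrite addrC subr_eq0; apply/eqP; apply: eq_bigr => k _.
congr (_ * _); apply: (@inv_rec_stable (size s).+2 (size s).+1);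
  by rewrite /= ltnS size_drop ?leqW ?leq_subr.
Qed.

End Inverse.

Lemma mmul_inverse_exists (F : Ginv) :
  exists G : Ginv, mmul F G = mone /\ mmul G F = mone.
Proof.
have [u [fu uf]] := ginv_invertible F.
pose g := Mult (@inv_multilinear F u).
have fg : mmul F g = mone by apply: inv_right.
have gh : mmul g (Mult (@inv_multilinear g (F 0 [tuple]))) = mone.
  by apply: inv_right.
have gI : invertible (g 0 [tuple]) by exists (F 0 [tuple]).
exists (MkGinv gI); split=> //=.
by rewrite -[X in mmul g X]mmulm1 -gh (mmulA F) fg mmul1m.
Qed.

(* The inverse F^{-1} for the product. *)
Definition ginv (F : Ginv) : Ginv :=
  sval (constructive_indefinite_description _ (mmul_inverse_exists F)).

Lemma gmulV (F : Ginv) : mmul F (ginv F) = mone /\ mmul (ginv F) F = mone.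
Proof. exact: proj2_sig (constructive_indefinite_description _ (mmul_inverse_exists F)). Qed.

(* The right arguments of the compositions below have zero constant term. *)
Lemma mmul_mid0 (f : mult) : mmul mid f 0 [tuple] = 0.
Proof. by rewrite mmul0 mul0r. Qed.

Lemma mmulr_mid0 (f : mult) : mmul f mid 0 [tuple] = 0.
Proof. by rewrite mmul0 mulr0. Qed.

Lemma mmul_mid_mul0 (f g : mult) : mmul (mmul f mid) g 0 [tuple] = 0.
Proof. by rewrite mmul0 mmulr_mid0 mul0r. Qed.

Definition tri_l (F G : Ginv) : Ginv := gcomp G (mmul mid F).
Definition tri_r (F G : Ginv) : Ginv := gcomp G (mmul F mid).
Definition tri (F G : Ginv) : Ginv := gcomp G (mmul (mmul (ginv F) mid) F).
Definition tri' (F G : Ginv) : Ginv := gcomp G (mmul (mmul F mid) (ginv F)).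

Definition star_l (F G : Ginv) : Ginv := gmul G (gcomp F (mmul mid G)).
Definition star_r (F G : Ginv) : Ginv := gmul (gcomp F (mmul G mid)) G.
Definition bullet (F G : Ginv) : Ginv :=
  gmul G (gcomp F (mmul (mmul (ginv G) mid) G)).
Definition bullet' (F G : Ginv) : Ginv :=
  gmul (gcomp F (mmul (mmul G mid) (ginv G))) G.

End Mult.

Arguments gmul {K B}.
Arguments tri_l {K B}.
Arguments tri_r {K B}.
Arguments tri {K B}.
Arguments tri' {K B}.
Arguments star_l {K B}.
Arguments star_r {K B}.
Arguments bullet {K B}.
Arguments bullet' {K B}.

(* Main.v *)
Require Import Defs.
From mathcomp Require Import all_boot all_order all_algebra.
From Stdlib Require Import FunctionalExtensionality ProofIrrelevance.

(** Write [o] for the composition of series, and call a series of the form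
[u I v], with [u] and [v] invertible, a sandwich.  All four
maps [tri_l], [tri_r], [tri], [tri'] have the form
[F |> G = G o (phi F . I . psi F)], where [(phi F, psi F)] is [(1, F)],
[(F, 1)], [(F^-1, F)] or [(F, F^-1)], and a single argument treats them all.

Three facts about the composition carry it: it is associative ([mcompA]), [I]
is a unit for it on series with zero constant term ([mcomp_midl],
[mcomp_midr]), and composing on the right with [g] respects products,
[(f . f') o g = (f o g) . (f' o g)] ([mcompM]).  The last one says that every
[F |> _] is an endomorphism of the product.  It also gives
[(u I v) o h = (u o h) . h . (v o h)], so that
[(phi G . I . psi G) o (phi F . I . psi F)] is the sandwich attached to
[F * (F |> G)] as soon as [psi] is a morphism and [phi] an antimorphism, both
compatible with composition, from the law [*], which is the product or its
opposite, to the product; by associativity this is the second axiom of a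
post-group ([sandwich_post_group]).

Bijectivity of [F |> _] amounts to the invertibility of sandwiches for
composition.  A right inverse [h] of [u I v] is a solution of
[h = (u^-1 o h) . I . (v^-1 o h)], whose right-hand side in degree [n] only
involves [h] in degrees less than [n], whence a solution by iteration
([contraction_fixpoint]).  This [h] is again a sandwich, so it has a right
inverse too, and both are then two-sided inverses ([sandwich_inverse]).

To prove the facts on composition, a series is seen as a function on lists, and
the sum over the compositions of [n] is replaced by a recursion on the list of
arguments ([seqcomp_cons]): the first block is chosen, then the rest is
composed.  Associativity and compatibility with products then reduce to the coassociativity of the splitting of a
list into two consecutive pieces ([split_sumA]). *)

Set Implicit Arguments.
Unset Strict Implicit.
Unset Printing Implicit Defensive.

Import GRing.Theory.
Local Open Scope ring_scope.

(** * Sums over the splittings of a list *)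

Section SplitSum.
Variables (U : Type) (W : nmodType).
Implicit Types (Phi : seq U -> seq U -> W) (s : seq U).

Definition split_sum Phi s : W :=
  \sum_(k < (size s).+1) Phi (take k s) (drop k s).

Lemma split_sum_nil Phi : split_sum Phi [::] = Phi [::] [::].
Proof. by rewrite /split_sum big_ord1. Qed.

Lemma split_sum_cons Phi x s :
  split_sum Phi (x :: s) =
  Phi [::] (x :: s) + split_sum (fun s1 => Phi (x :: s1)) s.
Proof. by rewrite /split_sum big_ord_recl. Qed.

Lemma eq_split_sum Phi Psi s :
    (forall s1 s2, s1 ++ s2 = s -> Phi s1 s2 = Psi s1 s2) ->
  split_sum Phi s = split_sum Psi s.
Proof. by move=> E; apply: eq_bigr => k _; apply: E; rewrite cat_take_drop. Qed.

Lemma split_sumD Phi Psi s :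
  split_sum (fun s1 s2 => Phi s1 s2 + Psi s1 s2) s =
  split_sum Phi s + split_sum Psi s.
Proof. exact: big_split. Qed.

(** Both sides are the sum over all splittings of [s] into three pieces. *)
Lemma split_sumA (Psi : seq U -> seq U -> seq U -> W) s :
  split_sum (fun a t => split_sum (Psi a) t) s =
  split_sum (fun t c => split_sum (fun a b => Psi a b c) t) s.
Proof.
elim: s Psi => [|x s IH] Psi; first by rewrite !split_sum_nil.
rewrite split_sum_cons [RHS]split_sum_cons split_sum_nil IH.
rewrite [split_sum _ (x :: s)]split_sum_cons -addrA -split_sumD.
by congr (_ + _); apply: eq_split_sum => t c _; rewrite split_sum_cons.
Qed.

End SplitSum.

Lemma split_sum_additive (U : Type) (V W : nmodType) (L : V -> W)
    (Phi : seq U -> seq U -> V) s :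
    {morph L : x y / x + y} ->
  split_sum (fun s1 s2 => L (Phi s1 s2)) s = L (split_sum Phi s).
Proof.
move=> LD; elim: s Phi => [|x s IH] Phi; first by rewrite !split_sum_nil.
by rewrite !split_sum_cons LD -IH.
Qed.

(** * Composition of functions on lists *)

Section SeqComp.
Variables (U V : Type) (W : nmodType).
Implicit Types (f : seq V -> W) (g b : seq U -> V) (s : seq U).

(** The function [b] stands for [g] with the elements already put in the
current block as first arguments: each new element either joins the current
block or closes it and opens the next one.  Keeping the current block open
makes the recursion structural. *)
Fixpoint seqcomp_open f g b s : W :=
  if s is x :: s' then
    seqcomp_open f g (fun t => b (x :: t)) s' +
    seqcomp_open (fun t => f (b [::] :: t)) g (fun t => g (x :: t)) s'
  else f [:: b [::]].

Definition seqcomp f g s : W :=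
  if s is x :: s' then seqcomp_open f g (fun t => g (x :: t)) s' else f [::].

Lemma seqcomp_cons f g x s :
  seqcomp f g (x :: s) =
  split_sum (fun s1 s2 => seqcomp (fun t => f (g (x :: s1) :: t)) g s2) s.
Proof.
suff E b : seqcomp_open f g b s =
    split_sum (fun s1 s2 => seqcomp (fun t => f (b s1 :: t)) g s2) s by exact: E.
elim: s f b => [|y s IH] f b; first by rewrite split_sum_nil.
by rewrite split_sum_cons /= IH addrC.
Qed.

Lemma seqcompD f f' g s :
  seqcomp (fun t => f t + f' t) g s = seqcomp f g s + seqcomp f' g s.
Proof.
case: s => [//|x s] /=; move: (fun t => g (x :: t)) => b.
by elim: s f f' b => [//|y s IH] f f' b /=; rewrite !IH addrACA.
Qed.

Lemma seqcomp0 g s : seqcomp (fun=> 0) g s = 0.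
Proof.
case: s => [//|x s] /=; move: (fun t => g (x :: t)) => b.
by elim: s b => [//|y s IH] b /=; rewrite !IH addr0.
Qed.

Lemma eq_seqcompr f g g' s :
    (forall t, (size t <= size s)%N -> g t = g' t) ->
  seqcomp f g s = seqcomp f g' s.
Proof.
have [n] := ubnP (size s); elim: n s f => // n IH [//|x s] f; rewrite [size _]/= ltnS => sn E.
rewrite !seqcomp_cons; apply: eq_split_sum => s1 s2 def_s.
have sz1 : (size s1 <= size s)%N by rewrite -def_s size_cat leq_addr.
have sz2 : (size s2 <= size s)%N by rewrite -def_s size_cat leq_addl.
rewrite (E (x :: s1)) //; apply: IH => [|t tP]; first exact: leq_ltn_trans sz2 sn.
by apply: E; rewrite ltnW // ltnS (leq_trans tP).
Qed.

End SeqComp.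

Lemma seqcomp_additive (U V : Type) (W W' : nmodType) (L : W -> W')
    (f : seq V -> W) (g : seq U -> V) s :
    {morph L : x y / x + y} ->
  seqcomp (fun t => L (f t)) g s = L (seqcomp f g s).
Proof.
move=> LD; case: s => [//|x s] /=; move: (fun t => g (x :: t)) => b.
by elim: s f b => [//|y s IH] f b /=; rewrite !IH LD.
Qed.

(** The common source of distributivity and associativity: blocks cut out of a
list [s] and then split into two groups are the same as a splitting of [s] into
two pieces, each cut into blocks. *)
Lemma seqcomp_split_sum (U V : Type) (W : nmodType)
    (Phi : seq V -> seq V -> W) (h : seq U -> V) s :
  seqcomp (split_sum Phi) h s =
  split_sum (fun s1 s2 => seqcomp (fun t => seqcomp (Phi t) h s2) h s1) s.
Proof.
have [n] := ubnP (size s); elim: n s Phi => // n IH [|x s] Phi.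
  by rewrite !split_sum_nil /= split_sum_nil.
rewrite [size _]/= ltnS => sn; rewrite split_sum_cons [LHS]seqcomp_cons.
transitivity (split_sum (fun s1 s2 =>
    seqcomp (fun t => Phi [::] (h (x :: s1) :: t)) h s2 +
    split_sum (fun p q =>
      seqcomp (fun t => seqcomp (Phi (h (x :: s1) :: t)) h q) h p) s2) s).
  apply: eq_split_sum => s1 s2 def_s; rewrite -IH.
    rewrite -seqcompD; congr seqcomp; apply: functional_extensionality => t.
    exact: split_sum_cons.
  by apply: leq_ltn_trans sn; rewrite -def_s size_cat leq_addl.
rewrite split_sumD -seqcomp_cons split_sumA; congr (_ + _).
by apply: eq_split_sum => s1 s2 _; rewrite seqcomp_cons.
Qed.

Definition multiadditive (V W : nmodType) (f : seq V -> W) : Prop :=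
  forall s t x y, f (s ++ (x + y) :: t) = f (s ++ x :: t) + f (s ++ y :: t).

(** Additivity of [f] is what allows the blocks of [seqcomp g h], which are
sums, to be taken out of the arguments of [f]. *)
Lemma seqcompA (U V : Type) (V' W : nmodType) (f : seq V' -> W)
    (g : seq V -> V') (h : seq U -> V) s :
    multiadditive f ->
  seqcomp (seqcomp f g) h s = seqcomp f (seqcomp g h) s.
Proof.
have [n] := ubnP (size s); elim: n s f => // n IH [//|x s] f; rewrite [size _]/= ltnS => sn fD.
rewrite seqcomp_cons [RHS]seqcomp_cons.
pose L q y := seqcomp (fun t => f (y :: t)) (seqcomp g h) q.
have LD q : {morph L q : y z / y + z}.
  move=> y z; rewrite /L -seqcompD; congr seqcomp.
  by apply: functional_extensionality => t; apply: (fD [::]).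
transitivity (split_sum (fun s1 s2 => split_sum (fun p q =>
    L q (seqcomp (fun t => g (h (x :: s1) :: t)) h p)) s2) s).
  apply: eq_split_sum => s1 s2 def_s.
  rewrite (_ : (fun t => _) = split_sum (fun a =>
      seqcomp (fun t => f (g (h (x :: s1) :: a) :: t)) g)); last first.
    by apply: functional_extensionality => t; rewrite seqcomp_cons.
  rewrite seqcomp_split_sum; apply: eq_split_sum => p q def_s2.
  rewrite -(seqcomp_additive _ _ _ (LD q)); congr seqcomp.
  apply: functional_extensionality => t; apply: IH => [|s' t' y z].
    by apply: leq_ltn_trans sn; rewrite -def_s -def_s2 !size_cat addnA leq_addl.
  exact: (fD (_ :: s')).
rewrite split_sumA; apply: eq_split_sum => s1 s2 _.
by rewrite (split_sum_additive _ _ (LD s2)) -seqcomp_cons.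
Qed.

Lemma seqcomp_mul (U V : Type) (R : pzRingType) (f f' : seq V -> R)
    (g : seq U -> V) s :
  seqcomp (split_sum (fun s1 s2 => f s1 * f' s2)) g s =
  split_sum (fun s1 s2 => seqcomp f g s1 * seqcomp f' g s2) s.
Proof.
rewrite seqcomp_split_sum; apply: eq_split_sum => s1 s2 _.
rewrite -(@seqcomp_additive _ _ _ _ ( *%R^~ _)); last by move=> y z; rewrite mulrDl.
congr seqcomp; apply: functional_extensionality => t.
by rewrite (@seqcomp_additive _ _ _ _ ( *%R _)) // => y z; rewrite mulrDr.
Qed.

(** The head of the tuple is [j.+1]: its value [0] is excluded by the
positivity condition, hence the shift of the index. *)
Lemma big_positive_tcons (W : nmodType) N l m (F : seq nat -> W) :
  \sum_(k : l.+1.-tuple 'I_N.+1 | all (fun i : 'I_N.+1 => 0 < i)%N k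
                                  && (sumn (map val k) == m)) F (map val k) =
  \sum_(j < N) \sum_(k : l.-tuple 'I_N.+1 | all (fun i : 'I_N.+1 => 0 < i)%N k
                                  && (j.+1 + sumn (map val k) == m)%N)
    F (j.+1 :: map val k).
Proof.
rewrite (reindex (fun p : 'I_N.+1 * l.-tuple 'I_N.+1 => cons_tuple p.1 p.2)) /=.
  rewrite -(pair_big_dep xpredT (fun (i : 'I_N.+1) (k : l.-tuple 'I_N.+1) =>
     (0 < i)%N && all (fun i : 'I_N.+1 => 0 < i)%N k
       && (i + sumn (map val k) == m)%N)
    (fun (i : 'I_N.+1) k => F (val i :: map val k))) /=.
  by rewrite big_ord_recl /= big_pred0 ?add0r.
exists (fun k => (thead k, behead_tuple k)) => [[i k] _ | k _] /=.
  by rewrite theadE; congr pair; apply: val_inj.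
by rewrite [RHS]tuple_eta; apply: val_inj.
Qed.

(** The bounds [M] and [N] on the number and on the lengths of the blocks are
kept independent of [s], since [s] shrinks in the induction. *)
Lemma sum_reshape (V : Type) (W : nmodType) (f : seq V -> W) (U : Type)
    (g : seq U -> V) M N s : (size s <= M)%N -> (size s <= N)%N ->
  \sum_(l < M.+1)
   \sum_(k : l.-tuple 'I_N.+1 | all (fun i : 'I_N.+1 => 0 < i)%N k
                                && (sumn (map val k) == size s))
     f [seq g b | b <- reshape (map val k) s] = seqcomp f g s.
Proof.
elim: M s f => [|M IH] [|x s] f // sM sN.
- rewrite big_ord1 (big_pred1 [tuple]) //= => k.
  by rewrite (tuple0 k) /= [RHS]eqxx.
- rewrite big_ord_recl (big_pred1 [tuple]) /=; last first.
    by move=> k; rewrite (tuple0 k) /= [RHS]eqxx.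
  rewrite big1 ?addr0 // => l _.
  rewrite (big_positive_tcons N l 0 (fun k => f [seq g b | b <- reshape k [::]])).
  by apply: big1 => j _; apply: big_pred0 => k; rewrite andbF.
rewrite big_ord_recl big_pred0 ?add0r; last by move=> k; rewrite (tuple0 k).
under eq_bigr => l _ do rewrite
  (big_positive_tcons N l (size s).+1 (fun k => f [seq g b | b <- reshape k (x :: s)])).
rewrite exchange_big seqcomp_cons /split_sum /=.
rewrite (big_ord_widen N (fun k => seqcomp
  (fun t => f (g (x :: take k s) :: t)) g (drop k s))) // [RHS]big_mkcond /=.
apply: eq_bigr => j _; rewrite ltnS; case: leqP => js; last first.
  apply: big1 => l _; apply: big_pred0 => k; rewrite addSn eqSS.
  by rewrite gtn_eqF ?andbF // ltn_addr.
rewrite -IH; first last.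
- by rewrite size_drop (leq_trans (leq_subr _ _)) // ltnW.
- by rewrite size_drop (leq_trans (leq_subr _ _)).
apply: eq_bigr => l _; apply: eq_bigl => k.
by rewrite size_drop addSn eqSS -[in LHS](subnKC js) eqn_add2l.
Qed.

(** * The algebra of multilinear series *)

Section Series.
Variables (K : fieldType) (B : algType K).
Implicit Types (f g h : mult B) (u v F G : Ginv B) (s : seq B).

Lemma mapp_multiadditive f : multiadditive (mapp f).
Proof. by move=> s t x y; have := mapp_lin f s t 1 x y; rewrite !scale1r. Qed.

Lemma mapp_mcomp f g s : mapp (mcomp f g) s = seqcomp (mapp f) (mapp g) s.
Proof. exact: sum_reshape. Qed.

Lemma mapp_mcomp_fun f g : mapp (mcomp f g) = seqcomp (mapp f) (mapp g).
Proof. by apply: functional_extensionality => s; apply: mapp_mcomp. Qed.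

Lemma mcompA f g h : mcomp (mcomp f g) h = mcomp f (mcomp g h).
Proof.
apply: mult_eq => s; rewrite !mapp_mcomp !mapp_mcomp_fun.
exact: seqcompA (@mapp_multiadditive f).
Qed.

Lemma mcompM f g h : mcomp (mmul f g) h = mmul (mcomp f h) (mcomp g h).
Proof.
apply: mult_eq => s; rewrite mapp_mcomp mapp_mmul !mapp_mcomp_fun.
exact: seqcomp_mul.
Qed.

Lemma seqcomp_nil_support (c : B) g s :
  seqcomp (fun t => if t is [::] then c else 0) (mapp g) s =
  if s is [::] then c else 0.
Proof.
case: s => [//|x s]; rewrite seqcomp_cons /split_sum.
by apply: big1 => k _; rewrite seqcomp0.
Qed.

Lemma mcomp_mone g : mcomp (mone B) g = mone B.
Proof.
apply: mult_eq => s; rewrite mapp_mcomp mapp_mone.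
have -> : mapp (mone B) = (fun t => if t is [::] then 1 else 0).
  by apply: functional_extensionality => -[].
by rewrite seqcomp_nil_support; case: s.
Qed.

Lemma mapp_mid s : mapp (mid B) s = if s is [:: x] then x else 0.
Proof. by case: s => [|x [|y s]]. Qed.

Lemma mapp_nil f : mapp f [::] = f 0 [tuple].
Proof. exact: (mappE f [tuple]). Qed.

Lemma mcomp_midl g : g 0 [tuple] = 0 -> mcomp (mid B) g = g.
Proof.
move=> g0; apply: mult_eq => -[|x s].
  by rewrite mapp_mcomp mapp_nil g0.
rewrite mapp_mcomp seqcomp_cons.
transitivity (split_sum
    (fun s1 s2 => if s2 is [::] then mapp g (x :: s1) else 0) s).
  apply: eq_split_sum => s1 s2 _; rewrite -(@seqcomp_nil_support _ g).
  congr seqcomp; apply: functional_extensionality => t.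
  by rewrite mapp_mid; case: t.
rewrite /split_sum big_ord_recr /= drop_size take_size big1 ?add0r // => k _.
have : (size (drop k s) != 0)%N by rewrite size_drop subn_eq0 -ltnNge.
by case: (drop k s).
Qed.

(** A block of length other than one contributes a zero argument to [f], so
only the decomposition into singletons remains.  The induction bears on the
functions [mapp f (p ++ _)], where [p] collects the singletons already cut. *)
Lemma mcomp_midr f : mcomp f (mid B) = f.
Proof.
apply: mult_eq => s; rewrite mapp_mcomp.
have f0 p t : mapp f (p ++ 0 :: t) = 0.
  apply: (@addIr _ (mapp f (p ++ 0 :: t))).
  by rewrite -mapp_multiadditive addr0 add0r.
suff E p : seqcomp (fun t => mapp f (p ++ t)) (mapp (mid B)) s = mapp f (p ++ s).
  exact: (E [::]).
elim: s p => [//|x s IH] p; rewrite seqcomp_cons /split_sum big_ord_recl.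
rewrite take0 drop0 mapp_mid big1 ?addr0 => [|k _].
  rewrite -cat_rcons -IH; congr seqcomp.
  by apply: functional_extensionality => t; rewrite cat_rcons.
rewrite mapp_mid lift0; case: s {IH} k => [[[]] //|y s k] /=.
rewrite -[RHS](seqcomp0 _ (mapp (mid B)) (drop k s)); congr seqcomp.
by apply: functional_extensionality => t; rewrite f0.
Qed.

(** * Invertibility of sandwiches for composition *)

Definition agree n f g := forall s, (size s < n)%N -> mapp f s = mapp g s.

(** Degree by degree, the iterates of [T] become stationary, and their limit
is the series whose term of degree [n] is that of the iterate [n + 1]. *)
Lemma contraction_fixpoint (T : mult B -> mult B) :
    (forall n f g, agree n f g -> agree n.+1 (T f) (T g)) ->
  exists h, T h = h.
Proof.
move=> Tc; pose H n := iter n T (mid B).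
have HS n m : (n <= m)%N -> agree n (H n) (H m).
  elim: n m => [|n IH] m; first by move=> _ s; rewrite ltn0.
  by case: m => // m nm; apply/Tc/IH.
pose h := @Mult _ _ (fun n => H n.+1 n) (fun n => @mfun_multilinear _ _ (H n.+1) n).
have hE s : mapp h s = mapp (H (size s).+1) s by [].
exists h; apply: mult_eq => s; rewrite hE; apply: (Tc (size s)) => // t ts.
by rewrite hE; apply: HS.
Qed.

Definition sandwich f g : mult B := mmul (mmul f (mid B)) g.

Lemma sandwich0 f g : sandwich f g 0 [tuple] = 0.
Proof. exact: mmul_mid_mul0. Qed.

Lemma mcomp_sandwich f g h : h 0 [tuple] = 0 ->
  mcomp (sandwich f g) h = mmul (mmul (mcomp f h) h) (mcomp g h).
Proof. by move=> h0; rewrite /sandwich !mcompM mcomp_midl. Qed.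

(** The letter [I] takes up one argument, so that a sandwich in degree at most
[n] only involves its outer factors in degree less than [n]. *)
Lemma agree_sandwich n f g f' g' :
  agree n f f' -> agree n g g' -> agree n.+1 (sandwich f g) (sandwich f' g').
Proof.
move=> ff gg s; rewrite ltnS => sn; rewrite !mapp_mmul.
have fI t : (size t <= n)%N -> mapp (mmul f (mid B)) t = mapp (mmul f' (mid B)) t.
  move=> tn; rewrite !mapp_mmul; apply: (@eq_split_sum _ _
    (fun s1 s2 => mapp f s1 * mapp (mid B) s2)
    (fun s1 s2 => mapp f' s1 * mapp (mid B) s2)) => s1 s2 def_t.
  rewrite mapp_mid; case: s2 def_t => [|x s2] def_t; first by rewrite !mulr0.
  by rewrite ff // (leq_trans _ tn) // -def_t size_cat addnS ltnS leq_addr.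
apply: (@eq_split_sum _ _
  (fun s1 s2 => mapp (mmul f (mid B)) s1 * mapp g s2)
  (fun s1 s2 => mapp (mmul f' (mid B)) s1 * mapp g' s2)) => s1 s2 def_s.
rewrite fI; last by rewrite (leq_trans _ sn) // -def_s size_cat leq_addr.
case: s1 def_s => [|x s1] def_s; first by rewrite mapp_nil mmulr_mid0 !mul0r.
by rewrite gg // (leq_trans _ sn) // -def_s size_cat /= addSn ltnS leq_addl.
Qed.

Lemma agree_mcomp n f g h : agree n g h -> agree n (mcomp f g) (mcomp f h).
Proof.
move=> gh s sn; rewrite !mapp_mcomp; apply: eq_seqcompr => t ts.
exact/gh/(leq_ltn_trans ts).
Qed.

(** The right inverse of a sandwich is itself a sandwich: this is what allows
the construction to be repeated in [sandwich_inverse]. *)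
Lemma sandwich_right_inverse u v : exists u' v' : Ginv B,
  mcomp (sandwich u v) (sandwich u' v') = mid B.
Proof.
pose T h := sandwich (mcomp (ginv u) h) (mcomp (ginv v) h).
have [n f g fg | h hE] := @contraction_fixpoint T.
  by apply: agree_sandwich; apply: agree_mcomp.
exists (gcomp (ginv u) h), (gcomp (ginv v) h).
have -> : sandwich (gcomp (ginv u) h) (gcomp (ginv v) h) = h by exact: hE.
rewrite mcomp_sandwich; last by rewrite -hE; apply: sandwich0.
rewrite -[X in mmul (mmul _ X) _]hE /T /sandwich !mmulA -mcompM (gmulV u).1.
rewrite -mmulA -mcompM (gmulV v).2.
by rewrite !mcomp_mone mmulm1 mmul1m.
Qed.

Lemma sandwich_inverse u v : exists h,
  mcomp (sandwich u v) h = mid B /\ mcomp h (sandwich u v) = mid B.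
Proof.
have [u' [v' gh]] := sandwich_right_inverse u v.
have [u'' [v'' hk]] := sandwich_right_inverse u' v'.
exists (sandwich u' v'); split=> //.
rewrite -[in RHS]hk; congr mcomp.
rewrite -[LHS]mcomp_midr -hk -mcompA gh mcomp_midl //; exact: sandwich0.
Qed.

(** * Post-groups from sandwiches *)

Lemma ginv_val_inj F G : F = G :> mult B -> F = G.
Proof.
by case: F G => [f fP] [g gP] /= fg; case: _ / fg gP => gP; congr MkGinv; apply: proof_irrelevance.
Qed.

Definition gone : Ginv B := @MkGinv _ _ (mone B) (invertible1 B).

Lemma gmul_group : group_law (@gmul K B).
Proof.
split=> [F G H|]; first by apply: ginv_val_inj; apply: mmulA.
exists gone; split=> [F|F|F]; try apply: ginv_val_inj.
- exact: mmul1m.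
- exact: mmulm1.
by exists (ginv F); split; apply: ginv_val_inj; case: (gmulV F).
Qed.

Lemma group_law_opposite (T : Type) (op : T -> T -> T) :
  group_law op -> group_law (opposite op).
Proof.
move=> [opA [e [e1 e2 eV]]]; split=> [a b c|]; first by rewrite /opposite opA.
exists e; split=> [a|a|a]; rewrite /opposite ?e1 ?e2 //.
by have [b [ab ba]] := eV a; exists b.
Qed.

Lemma ginv_unique F g : mmul F g = mone B -> g = ginv F.
Proof. by move=> Fg; rewrite -[LHS]mmul1m -(gmulV F).2 -mmulA Fg mmulm1. Qed.

Lemma ginvM F G : ginv (gmul F G) = gmul (ginv G) (ginv F).
Proof.
apply/esym/ginv_val_inj/ginv_unique => /=.
by rewrite -mmulA [mmul G _]mmulA (gmulV G).1 mmul1m (gmulV F).1.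
Qed.

Lemma ginv_gcomp F g : ginv (gcomp F g) = gcomp (ginv F) g.
Proof.
by apply/esym/ginv_val_inj/ginv_unique; rewrite /= -mcompM (gmulV F).1 mcomp_mone.
Qed.

Lemma gcomp_sandwich_bij u v : bijective (fun F => gcomp F (sandwich u v)).
Proof.
have [h [gh hg]] := sandwich_inverse u v.
exists (fun F => gcomp F h) => F; apply: ginv_val_inj => /=.
  by rewrite mcompA gh mcomp_midr.
by rewrite mcompA hg mcomp_midr.
Qed.

(** The law [op] is meant to be the product or its opposite, both of which are
preserved by composition on the right. *)
Lemma sandwich_post_group (op : Ginv B -> Ginv B -> Ginv B)
    (phi psi : Ginv B -> Ginv B) :
    group_law op ->
    (forall g, {morph (fun F => gcomp F g) : F G / op F G}) ->
    (forall F g, phi (gcomp F g) = gcomp (phi F) g) ->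
    (forall F g, psi (gcomp F g) = gcomp (psi F) g) ->
    (forall F G, phi (op F G) = gmul (phi G) (phi F)) ->
    (forall F G, psi (op F G) = gmul (psi F) (psi G)) ->
  post_group op (fun F G => gcomp G (sandwich (phi F) (psi F))).
Proof.
move=> opG opC phiC psiC phiM psiM; split=> // [F | F G H].
  by split; [apply: gcomp_sandwich_bij | move=> G H; apply: opC].
apply: ginv_val_inj; rewrite /= mcompA; congr mcomp.
rewrite mcomp_sandwich ?sandwich0 // /GL_product phiM psiM phiC psiC /=.
by rewrite /sandwich !mmulA.
Qed.

End Series.

Theorem lemma3p13 (K : fieldType) (charK0 : [pchar K] =i pred0) (B : algType K) :
  [/\ post_group (G := Ginv B) gmul tri_l /\
      GL_product (G := Ginv B) gmul tri_l =2 opposite star_l,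
      post_group (G := Ginv B) (opposite gmul) tri_r /\
      GL_product (G := Ginv B) (opposite gmul) tri_r =2 opposite star_r,
      post_group (G := Ginv B) gmul tri /\
      GL_product (G := Ginv B) gmul tri =2 opposite bullet
    & post_group (G := Ginv B) (opposite gmul) tri' /\
      GL_product (G := Ginv B) (opposite gmul) tri' =2 opposite bullet'].
Proof.
have mulG := gmul_group B; have oppG := group_law_opposite mulG.
have mulC g : {morph (fun F : Ginv B => gcomp F g) : F G / gmul F G}.
  by move=> F G; apply: ginv_val_inj; apply: mcompM.
have oppC g : {morph (fun F : Ginv B => gcomp F g) : F G / opposite gmul F G}.
  by move=> F G; apply: mulC.
have oneC g : gone B = gcomp (gone B) g.
  by apply: ginv_val_inj; rewrite /= mcomp_mone.
have oneM : gone B = gmul (gone B) (gone B).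
  by apply: ginv_val_inj; rewrite /= mmul1m.
split; split=> //.
- have -> : tri_l = fun F G : Ginv B => gcomp G (sandwich (gone B) F).
    apply: functional_extensionality => F; apply: functional_extensionality => G.
    by rewrite /sandwich /= mmul1m.
  exact: (sandwich_post_group (phi := fun=> gone B) (psi := id)).
- have -> : tri_r = fun F G : Ginv B => gcomp G (sandwich F (gone B)).
    apply: functional_extensionality => F; apply: functional_extensionality => G.
    by rewrite /sandwich /= mmulm1.
  exact: (sandwich_post_group (phi := id) (psi := fun=> gone B)).
- apply: (sandwich_post_group (phi := @ginv K B) (psi := id)) => //.
  + exact: ginv_gcomp.
  + exact: ginvM.
apply: (sandwich_post_group (phi := id) (psi := @ginv K B)) => //.
- exact: ginv_gcomp.
by move=> F G; rewrite -ginvM.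
Qed.
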